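(* Let $n\ge 2$ and let $M_B$ be the $n\times 2^n$ binary matrix whose $i$-th row ($1\le i\le n$) consists of $2^{i-1}$ consecutive blocks, each block being $2^{n-i}$ entries equal to $1$ followed by $2^{n-i}$ entries equal to $0$ (the Boolean form of a generating matrix of the Hadamard code of type $[2^n,n,2^{n-1}]_2$). Then there exist a Boolean algebra $\mathcal{B}$ with $2^n$ elements and an enumeration $b_1,\dots,b_{2^n}$ of its elements such that $\mathcal{B}$ has $n$ ideals $J_1,\dots,J_n$ of cardinality $2^{n-1}$ whose codewords $c_{J_1},\dots,c_{J_n}$ (with respect to this enumeration) are exactly the rows of $M_B$, $c_{J_i}$ being the $i$-th row.
   Context: An ideal of a Boolean algebra $\mathcal{B}$ is a nonempty subset $J\subseteq\mathcal{B}$ such that $x\le j\in J$ implies $x\in J$, and $i,j\in J$ implies $i\vee j\in J$. For a subset $J$ of $\mathcal{B}=\{b_1,\dots,b_{2^n}\}$, its codeword is $c_J=(c_1,\dots,c_{2^n})\in\mathbb{Z}_2^{2^n}$ with $c_k=1$ if $b_k\in J$ and $c_k=0$ otherwise. *)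

(* Defs.v *)
From HB Require Import structures.
From mathcomp Require Import all_boot all_order all_algebra.

Set Implicit Arguments.
Unset Strict Implicit.
Unset Printing Implicit Defensive.

Import Order.TTheory GRing.Theory.

(* Finite Boolean algebras are the finCTBDistrLatticeType's of the library:
   finite complemented distributive lattices with bottom and top. *)

Definition is_ideal (d : Order.disp_t) (B : finCTBDistrLatticeType d)
    (J : {set B}) : Prop :=
  [/\ J != set0,
      forall x j : B, (x <= j)%O -> j \in J -> x \in J
    & forall i j : B, i \in J -> j \in J -> (i `|` j)%O \in J].

Definition codeword (d : Order.disp_t) (B : finCTBDistrLatticeType d) (m : nat)
    (b : 'I_m -> B) (J : {set B}) : 'rV['Z_2]_m :=
  (\row_(k < m) (if b k \in J then 1 else 0))%R.

(* Rows are indexed from 0, so index i stands for row i + 1: it is made of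
   2 ^ i blocks, each with 2 ^ (n - (i + 1)) ones followed by as many zeros. *)
Definition MB_row (n i : nat) : seq 'Z_2 :=
  flatten (nseq (2 ^ i)
    (nseq (2 ^ (n - i.+1)) 1%R ++ nseq (2 ^ (n - i.+1)) 0%R)).

(* The default value of nth is never used when i < n. *)
Lemma size_MB_row (n i : nat) : i < n -> size (MB_row n i) = 2 ^ n.
Proof.
move=> lt_in.
rewrite /MB_row size_flatten /shape map_nseq sumn_nseq size_cat !size_nseq.
rewrite addnn -mul2n -expnS -expnD; congr (2 ^ _).
by rewrite -subSn // subSS subnK // ltnW.
Qed.

Definition MB (n : nat) : 'M['Z_2]_(n, 2 ^ n) :=
  (\matrix_(i < n, k < 2 ^ n) nth 0 (MB_row n i) k)%R.

(* Main.v *)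
Require Import Defs.
From HB Require Import structures.
From mathcomp Require Import all_boot all_order all_algebra.

Import Order.SetSubsetOrder Order.DefaultSetSubsetOrder.

(** Take for [B] the power set of [{0, ..., n-1}] ordered by inclusion, and let
    [b k] be the set of positions of the ones in the [n]-digit binary expansion
    of [k], most significant digit first. The principal ideal [J i] generated by
    the complement of [{i}] contains [b k] exactly when digit [i] of [k] is [0],
    that is, when [k] lies in the first half of its block of length
    [2 ^ (n - i)]. *)

Lemma nth_flatten_nseq (T : Type) (x0 : T) (s : seq T) (a k : nat) :
  k < a * size s -> nth x0 (flatten (nseq a s)) k = nth x0 s (k %% size s).
Proof.
elim: a k => [|a IHa] k /=; first by rewrite mul0n.
rewrite nth_cat mulSn => lt_k; case: ltnP => [lt_ks|le_sk].
  by rewrite modn_small.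
by rewrite IHa ?ltn_subLR // -[in RHS](subnK le_sk) modnDr.
Qed.

(** Division by [m] turns the comparison into [(k %/ m) %% 2 < 1]: one parity bit decides which half
    of its block contains [k]. *)
Lemma ltn_mod_double (m k : nat) : 0 < m -> (k %% (m + m) < m) = ~~ odd (k %/ m).
Proof.
move=> m_gt0; rewrite addnn -mul2n -[ltnRHS]mul1n -ltn_divLR // -modn_divl modn2.
by case: (odd _).
Qed.

(** Induction on the number of digits: digit 0 gives the parity, and digit [j] of [k./2] is digit
    [j.+1] of [k]. *)
Lemma binary_digits_inj (n k l : nat) : k < 2 ^ n -> l < 2 ^ n ->
  (forall j, j < n -> odd (k %/ 2 ^ j) = odd (l %/ 2 ^ j)) -> k = l.
Proof.
elim: n k l => [|n IHn] k l; first by case: k; case: l.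
rewrite expnS mul2n => lt_k lt_l eq_digits.
rewrite -[k]odd_double_half -[l]odd_double_half.
have /= := eq_digits 0 isT; rewrite !divn1 => ->.
rewrite (IHn k./2 l./2) // ?ltn_half_double // => j lt_jn.
by rewrite -!divn2 -!divnMA -expnS eq_digits.
Qed.

Definition binary_support (n : nat) (k : 'I_(2 ^ n)) : {set 'I_n} :=
  [set i : 'I_n | odd (k %/ 2 ^ (n - i.+1))].

Lemma binary_support_inj (n : nat) : injective (binary_support n).
Proof.
move=> k l /setP eq_kl; apply/val_inj/(binary_digits_inj n) => [||j lt_jn]; rewrite ?ltn_ord //.
(* Digit [j] is recorded at index [n - j.+1], because [n - (n - j.+1).+1 = j]. *)
by have := eq_kl (rev_ord (Ordinal lt_jn)); rewrite !inE /= subnSK // subKn // ltnW.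
Qed.

Lemma binary_support_bij (n : nat) : bijective (binary_support n).
Proof.
apply: inj_card_bij (binary_support_inj n) _.
by rewrite -cardsT -powersetT card_powerset cardsT !card_ord.
Qed.

Definition avoiding (n : nat) (i : 'I_n) : {set {set 'I_n}} := powerset [set~ i].

Lemma in_avoiding (n : nat) (i : 'I_n) (A : {set 'I_n}) : (A \in avoiding n i) = (i \notin A).
Proof. by rewrite powersetE subsetC sub1set inE. Qed.

Lemma avoiding_inj (n : nat) : injective (avoiding n).
Proof.
(* The singleton of [i] separates the ideals: it is outside [avoiding n i], but inside
   [avoiding n j] whenever [j != i]. *)
move=> i j /setP /(_ [set i]); rewrite !in_avoiding !inE eqxx /=.
by move/esym/negbFE/eqP.
Qed.

Lemma avoiding_ideal (n : nat) (i : 'I_n) : is_ideal (avoiding n i).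
Proof.
split=> [|A C|A C].
- by apply/set0Pn; exists set0; rewrite in_avoiding inE.
- by rewrite leEsubset !in_avoiding => /subsetP sAC; apply: contra => /sAC.
- by rewrite joinEsubset !in_avoiding in_setU negb_or => -> ->.
Qed.

Lemma card_avoiding (n : nat) (i : 'I_n) : #|avoiding n i| = 2 ^ (n - 1).
Proof. by rewrite card_powerset cardsC1 card_ord subn1. Qed.

Lemma codeword_avoiding (n : nat) (i : 'I_n) :
  codeword (binary_support n) (avoiding n i) = row i (MB n).
Proof.
apply/rowP=> k; rewrite !mxE in_avoiding inE /MB_row.
set m := 2 ^ (n - i.+1); set s := nseq m _ ++ _.
have size_s : size s = m + m by rewrite size_cat !size_nseq.
(* The total length of the row keeps [k] within the repeated blocks, so that [nth] can be computed
   in a single block. *)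
have lt_k : k < 2 ^ i * size s.
  by have := size_MB_row (ltn_ord i);
     rewrite /MB_row size_flatten /shape map_nseq sumn_nseq mulnC => ->.
rewrite nth_flatten_nseq // size_s nth_cat size_nseq ltn_mod_double ?expn_gt0 //.
(* In the half of zeros the default value of [nth] is also 0, so only the half of ones needs a range
   check. *)
case: ifP => digit_k; rewrite nth_nseq; last by rewrite if_same.
by rewrite ltn_mod_double ?expn_gt0 // digit_k.
Qed.

Theorem theorem3 (n : nat) (hn : 2 <= n) :
  exists (d : Order.disp_t) (B : finCTBDistrLatticeType d) (b : 'I_(2 ^ n) -> B),
    [/\ #|B| = 2 ^ n,
        bijective b
      & exists J : 'I_n -> {set B},
          [/\ injective J,
              forall i : 'I_n, is_ideal (J i),
              forall i : 'I_n, #|J i| = 2 ^ (n - 1)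
            & forall i : 'I_n, codeword b (J i) = row i (MB n)]].
Proof.
exists _, {set 'I_n}, (binary_support n); split.
- by rewrite -(bij_eq_card (binary_support_bij n)) card_ord.
- exact: binary_support_bij.
- exists (avoiding n); split.
  + exact: avoiding_inj.
  + exact: avoiding_ideal.
  + exact: card_avoiding.
  + exact: codeword_avoiding.
Qed.
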